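(* Let $n\ge3$ and let $T\colon M_n(\mathbb F)\to M_n(\mathbb F)$ be a bijective real-linear map. The following are equivalent. (i) $\|T(A)^*T(B)\|=\|T(A)\|\,\|T(B)\|$ for all $A,B$ with $\|A^*B\|=\|A\|\,\|B\|$. (ii) $\|T(A)T(B)^*\|=\|T(A)\|\,\|T(B)\|$ for all $A,B$ with $\|AB^*\|=\|A\|\,\|B\|$. (iii) There are $r>0$ and $U,V\in\mathcal U_n(\mathbb F)$ such that $T(A)=rUAV$ for all $A$, or $T(A)=rU\overline{A}V$ for all $A$.
   Context: $\mathbb F$ denotes either $\mathbb C$ or $\mathbb R$, $A^*$ the conjugate transpose (transpose if $\mathbb F=\mathbb R$), $\overline A$ the entrywise complex conjugate, $\mathcal U_n(\mathbb F)=\{A: A^*A=I_n\}$, and $\|\cdot\|$ the spectral norm. *)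

(* Defs.v *)
From HB Require Import structures.
From mathcomp Require Import all_boot all_order all_algebra.
From mathcomp Require Import classical_sets reals.
From mathcomp.real_closed Require Import complex.
Set Implicit Arguments. Unset Strict Implicit. Unset Printing Implicit Defensive.
Import Order.TTheory GRing.Theory Num.Theory.
Local Open Scope ring_scope.
Local Open Scope classical_set_scope.

(* The scalar field F is either R or C = R[i] (R : realType).  To treat both
   at once, the definitions below are parameterised by the data of F:
     cj  : F -> F   entrywise complex conjugation (identity if F = R),
     ab2 : F -> R   squared modulus |z|^2,
     emb : R -> F   the embedding of the reals (real scalars).           *)

Section Generic.
Variables (R : realType) (F : comNzRingType).
Variables (cj : F -> F) (ab2 : F -> R) (emb : R -> F).

Definition adj m n (A : 'M[F]_(m, n)) : 'M[F]_(n, m) := map_mx cj A^T.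

Definition cmx m n (A : 'M[F]_(m, n)) : 'M[F]_(m, n) := map_mx cj A.

Definition vnorm n (x : 'cV[F]_n) : R := Num.sqrt (\sum_i ab2 (x i 0)).

Definition specnorm n (A : 'M[F]_n) : R :=
  sup [set vnorm (A *m x) | x in [set x : 'cV[F]_n | vnorm x = 1]].

Definition unitary n (U : 'M[F]_n) : Prop := adj U *m U = 1%:M.

Definition real_linear n (T : 'M[F]_n -> 'M[F]_n) : Prop :=
  (forall A B, T (A + B) = T A + T B) /\
  (forall (r : R) A, T (emb r *: A) = emb r *: T A).

Definition cond_i n (T : 'M[F]_n -> 'M[F]_n) : Prop :=
  forall A B, specnorm (adj A *m B) = specnorm A * specnorm B ->
    specnorm (adj (T A) *m T B) = specnorm (T A) * specnorm (T B).

Definition cond_ii n (T : 'M[F]_n -> 'M[F]_n) : Prop :=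
  forall A B, specnorm (A *m adj B) = specnorm A * specnorm B ->
    specnorm (T A *m adj (T B)) = specnorm (T A) * specnorm (T B).

Definition cond_iii n (T : 'M[F]_n -> 'M[F]_n) : Prop :=
  exists (r : R), 0 < r /\ exists U V : 'M[F]_n, unitary U /\ unitary V /\
    ((forall A, T A = emb r *: (U *m A *m V)) \/
     (forall A, T A = emb r *: (U *m cmx A *m V))).

Definition Thm6 : Prop :=
  forall (n : nat) (T : 'M[F]_n -> 'M[F]_n),
    (3 <= n)%N -> bijective T -> real_linear T ->
    [<-> cond_i T; cond_ii T; cond_iii T].

End Generic.

Definition Thm6_real (R : realType) : Prop :=
  @Thm6 R R id (fun x => x ^+ 2) id.

Definition Thm6_complex (R : realType) : Prop :=
  @Thm6 R R[i] (@conjc R) (fun z => complex.Re z ^+ 2 + complex.Im z ^+ 2)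
    (fun r => (r%:C)%C).

(* Main.v *)
Require Import Defs.
From mathcomp Require Import all_boot all_order all_fingroup all_algebra.
From mathcomp Require Import classical_sets reals.
From mathcomp.real_closed Require Import complex.
From mathcomp Require Import ring lra.
Set Implicit Arguments. Unset Strict Implicit. Unset Printing Implicit Defensive.
Import Order.TTheory GRing.Theory Num.Theory.
Local Open Scope ring_scope.

(** Write L(A) for the eigenspace of A A^* for its largest eigenvalue |A|^2.  Then |A^* B| = |A||B| iff L(A) and L(B) meet nontrivially.  For x <> 0 choose A with T A = x x^*, whose L is the line of x, and u <> 0 in L(A): if u is in L(B), then x is in L(T B).  Testing this on u w^* + t C with u^* C = 0, C w = 0 and t small shows that x is an eigenvector of T(A) T(A)^* as soon as u is one of A A^*.  For y orthogonal to x, the quadratic form A |-> y^* T(A) T(A)^* x thus vanishes on all these A, and for n >= 3 this forces T(A)^* x = 0 -> A^* u = 0.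
    So the inverse S of T maps { B | x^* B = 0 } into { A | u^* A = 0 }.  Letting x run over the e_i and the e_j - c e_i, up to a left factor S acts on each row by multiples of one semilinear map, so that T(A) = P A Q or P (cmx A) Q; finally T(W) T(W)^* is scalar for W unitary, which makes P and Q multiples of unitary matrices.  Statement (ii) is (i) for A |-> T(A^* )^*. *)

Section SpectralNorm.
Variables (R : realType) (F : fieldType).
Variables (cj : {rmorphism F -> F}) (emb : {rmorphism R -> F}) (ab2 : F -> R).
Hypothesis cjK : involutive cj.
Hypothesis cj_emb : forall r, cj (emb r) = emb r.
Hypothesis ab2E : forall z, emb (ab2 z) = z * cj z.
Hypothesis ab2_ge0 : forall z, 0 <= ab2 z.

Local Notation adj := (adj cj).
Local Notation N := (@specnorm R F ab2 _).

(** * Scalars, adjoints and squared vector norms *)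

Lemma additive_map0 (V W : zmodType) (f : V -> W) :
  (forall A B, f (A + B) = f A + f B) -> f 0 = 0.
Proof. by move=> fD; apply: (addrI (f 0)); rewrite -fD !addr0. Qed.

Lemma emb_inj : injective emb. Proof. exact: fmorph_inj. Qed.

Lemma ab2_eq0 z : (ab2 z == 0) = (z == 0).
Proof.
rewrite -(inj_eq emb_inj) ab2E rmorph0 mulf_eq0 fmorph_eq0.
by case: (z == 0).
Qed.

Lemma ab2M a b : ab2 (a * b) = ab2 a * ab2 b.
Proof. by apply: emb_inj; rewrite rmorphM !ab2E rmorphM /=; ring. Qed.

Lemma ab2_emb r : ab2 (emb r) = r ^+ 2.
Proof. by apply: emb_inj; rewrite ab2E cj_emb rmorphXn /= expr2. Qed.

Lemma ab2_cj z : ab2 (cj z) = ab2 z.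
Proof. by apply: emb_inj; rewrite !ab2E cjK mulrC. Qed.

Lemma ab2D_le a b : ab2 (a + b) <= 2 * ab2 a + 2 * ab2 b.
Proof.
(* Parallelogram law; dropping the nonnegative [ab2 (a - b)] leaves the inequality. *)
have : ab2 (a + b) + ab2 (a - b) = 2 * ab2 a + 2 * ab2 b.
  apply: emb_inj; rewrite !(rmorphD, rmorphM, rmorph_nat) /= !ab2E rmorphD rmorphB /=.
  ring.
by move=> <-; rewrite lerDl.
Qed.

Lemma adjM m n p (A : 'M[F]_(m, n)) (B : 'M_(n, p)) :
  adj (A *m B) = adj B *m adj A.
Proof. by rewrite /adj trmx_mul map_mxM. Qed.

Lemma adjK m n (A : 'M[F]_(m, n)) : adj (adj A) = A.
Proof. by apply/matrixP => i j; rewrite !mxE cjK. Qed.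

Lemma adjD m n (A B : 'M[F]_(m, n)) : adj (A + B) = adj A + adj B.
Proof. by rewrite /adj linearD /= map_mxD. Qed.

Lemma adjN m n (A : 'M[F]_(m, n)) : adj (- A) = - adj A.
Proof. by rewrite /adj linearN /= map_mxN. Qed.

Lemma adjB m n (A B : 'M[F]_(m, n)) : adj (A - B) = adj A - adj B.
Proof. by rewrite adjD adjN. Qed.

Lemma adjZ m n a (A : 'M[F]_(m, n)) : adj (a *: A) = cj a *: adj A.
Proof. by rewrite /adj linearZ /= map_mxZ. Qed.

Lemma adj0 m n : adj (0 : 'M[F]_(m, n)) = 0.
Proof. by apply/matrixP => i j; rewrite !mxE rmorph0. Qed.

Lemma adj_scalar n a : adj (a%:M : 'M[F]_n) = (cj a)%:M.
Proof. by rewrite /adj tr_scalar_mx map_scalar_mx. Qed.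

Lemma adj1 n : adj (1%:M : 'M[F]_n) = 1%:M.
Proof. by rewrite adj_scalar rmorph1. Qed.

Lemma adj_mul_eq0C m n p (A : 'M[F]_(m, n)) (B : 'M_(m, p)) :
  adj A *m B = 0 -> adj B *m A = 0.
Proof. by move=> h; rewrite -[LHS]adjK adjM adjK h adj0. Qed.

(** The square of [vnorm]: without the root, norm identities are polynomial and can be checked in F
    after applying [emb]. *)
Definition nsq n (x : 'cV[F]_n) : R := \sum_i ab2 (x i 0).

Lemma nsq_ge0 n (x : 'cV[F]_n) : 0 <= nsq x.
Proof. exact: sumr_ge0. Qed.

Lemma nsq_eq0 n (x : 'cV[F]_n) : (nsq x == 0) = (x == 0).
Proof.
apply/eqP/eqP => [x0|->]; last first.
  by apply: big1 => i _; apply/eqP; rewrite ab2_eq0 mxE.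
apply/colP => i; apply/eqP; rewrite mxE -ab2_eq0.
exact/eqP/(psumr_eq0P _ x0).
Qed.

Lemma nsq0 n : nsq (0 : 'cV[F]_n) = 0.
Proof. exact/eqP/(etrans (nsq_eq0 _))/eqxx. Qed.

Lemma nsq_gt0 n (x : 'cV[F]_n) : (0 < nsq x) = (x != 0).
Proof. by rewrite lt_neqAle nsq_ge0 andbT eq_sym nsq_eq0. Qed.

Lemma nsqZ n a (x : 'cV[F]_n) : nsq (a *: x) = ab2 a * nsq x.
Proof. by rewrite /nsq mulr_sumr; apply: eq_bigr => i _; rewrite mxE ab2M. Qed.

Lemma adj_mul_self n (x : 'cV[F]_n) : adj x *m x = (emb (nsq x))%:M.
Proof.
apply/matrixP => i j; rewrite !ord1 !mxE eqxx mulr1n rmorph_sum.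
by apply: eq_bigr => k _; rewrite !mxE ab2E mulrC.
Qed.

Lemma nsq_inj1 n (x : 'cV[F]_n) r : adj x *m x = (emb r)%:M -> nsq x = r.
Proof.
rewrite adj_mul_self => /matrixP /(_ 0 0); rewrite !mxE eqxx !mulr1n.
exact: emb_inj.
Qed.

(** Both cross terms equal |A x|^2. The left side is nonnegative and vanishes exactly when A^* A x =
    s x; both facts are exploited below. *)
Lemma nsq_defect m n (A : 'M[F]_(m, n)) s (x : 'cV[F]_n) :
  nsq (emb s *: x - adj A *m (A *m x)) =
    s ^+ 2 * nsq x - 2 * s * nsq (A *m x) + nsq (adj A *m (A *m x)).
Proof.
apply: nsq_inj1; rewrite adjB adjZ cj_emb mulmxBr !mulmxBl.
rewrite -!scalemxAl -!scalemxAr adj_mul_self.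
have e1 : adj (adj A *m (A *m x)) *m x = (emb (nsq (A *m x)))%:M.
  by rewrite adjM adjK -mulmxA adj_mul_self.
have e2 : adj x *m (adj A *m (A *m x)) = (emb (nsq (A *m x)))%:M.
  by rewrite mulmxA -adjM adj_mul_self.
rewrite e1 e2 adj_mul_self.
apply/matrixP => i j; rewrite !ord1 !mxE eqxx !mulr1n.
by rewrite !(rmorphD, rmorphN, rmorphM, rmorphXn, rmorph_nat) /=; ring.
Qed.

(** * Bounds on the square of the operator norm *)

Definition opbound m n (A : 'M[F]_(m, n)) (s : R) :=
  forall x : 'cV[F]_n, nsq (A *m x) <= s * nsq x.

(** The factor 2 is lossy; the lemma only serves to show that some bound exists. *)
Lemma opboundD m n (A B : 'M[F]_(m, n)) a b :
  opbound A a -> opbound B b -> opbound (A + B) (2 * a + 2 * b).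
Proof.
move=> ha hb x; rewrite mulmxDl; apply: (@le_trans _ _ (2 * nsq (A *m x) + 2 * nsq (B *m x))).
  rewrite /nsq !mulr_sumr -big_split /=; apply: ler_sum => i _.
  by rewrite mxE ab2D_le.
by have := ha x; have := hb x; lra.
Qed.

Lemma opbound_ex m n (A : 'M[F]_(m, n)) : exists2 s, 0 < s & opbound A s.
Proof.
pose Q (B : 'M[F]_(m, n)) := exists2 s, 0 < s & opbound B s.
have Q0 : Q 0 by exists 1 => // x; rewrite mul0mx nsq0 mul1r nsq_ge0.
have QD B C : Q B -> Q C -> Q (B + C).
  move=> [b b0 hb] [c c0 hc]; exists (2 * b + 2 * c); first by lra.
  exact: opboundD.
rewrite [A]matrix_sum_delta; apply: (big_ind Q) => // i _.
apply: (big_ind Q) => // j _; exists (1 + ab2 (A i j)).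
  by rewrite ltr_wpDr.
move=> x; rewrite -scalemxAl nsqZ.
have -> : nsq (delta_mx i j *m x) = ab2 (x j 0).
  rewrite /nsq (bigD1 i) //= big1 ?addr0 => [|k ki].
    congr ab2; rewrite mxE (bigD1 j) //= big1 ?addr0.
      by rewrite mxE !eqxx mul1r.
    by move=> l lj; rewrite mxE (negbTE lj) andbF mul0r.
  apply/eqP; rewrite ab2_eq0 mxE big1 // => l _.
  by rewrite mxE (negbTE ki) mul0r.
have : ab2 (x j 0) <= nsq x.
  by rewrite /nsq (bigD1 j) //= lerDl sumr_ge0.
have := ab2_ge0 (A i j); have := ab2_ge0 (x j 0); nra.
Qed.

Lemma opbound_ge0 m n (A : 'M[F]_(m, n.+1)) s : opbound A s -> 0 <= s.
Proof.
move=> /(_ (const_mx 1)) h.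
have p : 0 < nsq (const_mx 1 : 'cV[F]_n.+1).
  rewrite nsq_gt0; apply/eqP => /colP /(_ 0) /eqP.
  by rewrite !mxE oner_eq0.
by rewrite -(pmulr_lge0 _ p) (le_trans (nsq_ge0 _) h).
Qed.

(** Expanding 0 <= |s y - A A^* y|^2 and bounding |A A^* y|^2 by s |A^* y|^2 leaves 0 <= s (s |y|^2
    - |A^* y|^2). *)
Lemma opbound_adj m n (A : 'M[F]_(m, n)) s :
  0 < s -> opbound A s -> opbound (adj A) s.
Proof.
move=> s0 hA y; have := nsq_defect (adj A) s y; rewrite adjK => e.
have := nsq_ge0 (emb s *: y - A *m (adj A *m y)); rewrite e.
have := hA (adj A *m y); set q := nsq _; set p := nsq _ => h1 h2.
have : s * (s * nsq y - p) >= 0.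
  by have -> : s * (s * nsq y - p) = s ^+ 2 * nsq y - 2 * s * p + s * p; [ring|lra].
by rewrite pmulr_rge0 // subr_ge0.
Qed.

(** Where the bound is attained, the defect |s x - A^* A x|^2 is at most -s^2 |x|^2 + s |A x|^2 =
    0. *)
Lemma opbound_eigen m n (A : 'M[F]_(m, n)) s x : 0 <= s -> opbound A s ->
  nsq (A *m x) = s * nsq x -> adj A *m (A *m x) = emb s *: x.
Proof.
rewrite le_eqVlt => /orP[/eqP <- _ | s0 hA e].
  rewrite mul0r => /eqP; rewrite nsq_eq0 => /eqP ->.
  by rewrite mulmx0 rmorph0 scale0r.
apply/esym/eqP; rewrite -subr_eq0 -nsq_eq0 eq_le nsq_ge0 andbT nsq_defect e.
by have := opbound_adj s0 hA (A *m x); rewrite e; nra.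
Qed.

Lemma eigen_nsq m n (A : 'M[F]_(m, n)) s x :
  adj A *m (A *m x) = emb s *: x -> nsq (A *m x) = s * nsq x.
Proof.
move=> h; apply: nsq_inj1.
by rewrite adjM -mulmxA h -scalemxAr adj_mul_self rmorphM scale_scalar_mx.
Qed.

(* If s - A*A were invertible, then |x|^2 <= c |(s - A*A) x|^2 <= c s (s |x|^2 - |A x|^2), and s could be decreased. *)
Lemma least_opbound_eigen m n (A : 'M[F]_(m, n.+1)) s :
  opbound A s -> (forall t, opbound A t -> s <= t) ->
  exists2 x : 'cV[F]_n.+1, x != 0 & adj A *m (A *m x) = emb s *: x.
Proof.
move=> hA smin; have s_ge0 := opbound_ge0 hA.
pose H := (emb s)%:M - adj A *m A.
case: (boolP (H \in unitmx)) => [uH|]; last first.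
  rewrite unitmxE unitfE negbK -det_tr => /det0P[v v0 vH].
  exists v^T; first by rewrite -trmx0 (inj_eq trmx_inj).
  move/(congr1 trmx): vH; rewrite trmx0 trmx_mul trmxK /H mulmxBl mul_scalar_mx -mulmxA.
  by move/eqP; rewrite subr_eq0 => /eqP <-.
have [c c0 hc] := opbound_ex (invmx H).
move: s_ge0; rewrite le_eqVlt => /orP[/eqP s0 | s0].
  exists (const_mx 1); first by apply/eqP => /colP /(_ 0) /eqP; rewrite !mxE oner_eq0.
  apply: opbound_eigen => //; first by rewrite -s0.
  by apply/eqP; rewrite eq_le hA /= -s0 mul0r nsq_ge0.
(* [(c * s)^-1] comes from solving |x|^2 <= c s (s |x|^2 - |A x|^2) for |A x|^2. *)
have : s <= s - (c * s)^-1.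
  apply: smin => x.
  have := hc (H *m x); rewrite mulKmx //.
  have -> : H *m x = emb s *: x - adj A *m (A *m x).
    by rewrite /H mulmxBl mul_scalar_mx mulmxA.
  rewrite nsq_defect => h1.
  have h2 := opbound_adj s0 hA (A *m x).
  have h3 : nsq x <= (c * s) * (s * nsq x - nsq (A *m x)).
    apply: (le_trans h1); rewrite -(mulrA c s) ler_pM2l //.
    have -> : s * (s * nsq x - nsq (A *m x)) = s ^+ 2 * nsq x - 2 * s * nsq (A *m x) +
        s * nsq (A *m x) by ring.
    by rewrite lerD2l.
  by rewrite mulrBl lerBrDr -lerBrDl ler_pdivrMl ?mulr_gt0.
by rewrite lerDl oppr_ge0 leNgt invr_gt0 mulr_gt0.
Qed.

(** * The spectral norm and its top left singular vectors *)

(** Trades the supremum for the least bound, the only description of the norm used later. Size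
    [n.+1] provides a unit vector, so the supremum is over a nonempty set. *)
Lemma specnorm_least n (A : 'M[F]_n.+1) :
  [/\ 0 <= N A, opbound A (N A ^+ 2) & forall t, opbound A t -> N A ^+ 2 <= t].
Proof.
pose S := [set vnorm ab2 (A *m x) | x in [set x : 'cV[F]_n.+1 | vnorm ab2 x = 1]]%classic.
have S0 : (S !=set0)%classic.
  exists (vnorm ab2 (A *m delta_mx 0 0)), (delta_mx 0 0) => //=.
  rewrite /vnorm (bigD1 0) //= big1 => [|i i0].
    by rewrite mxE !eqxx addr0 -(rmorph1 emb) ab2_emb expr1n sqrtr1.
  by apply/eqP; rewrite ab2_eq0 mxE (negbTE i0).
have ubS t : opbound A t -> ubound S (Num.sqrt t).
  move=> hA _ [x /= x1 <-]; rewrite ler_wsqrtr //; apply: le_trans (hA x) _.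
  have : nsq x = 1 by rewrite -[nsq x]sqr_sqrtr ?nsq_ge0 // [Num.sqrt _]x1 expr1n.
  by move=> ->; rewrite mulr1.
have [c c0 hc] := opbound_ex A.
have bS : has_sup S by split => //; exists (Num.sqrt c); apply: ubS.
have N0 : 0 <= N A.
  have [y Sy] := S0; apply: le_trans (sup_upper_bound bS Sy).
  by case: Sy => x _ <-; apply: sqrtr_ge0.
split => // [x|t ht]; last first.
  rewrite -(sqr_sqrtr (opbound_ge0 ht)) ler_pXn2r ?nnegrE ?sqrtr_ge0 //.
  by apply: ge_sup => //; apply: ubS.
have [->|x0] := eqVneq x 0; first by rewrite mulmx0 nsq0 mulr0.
have p0 : 0 < nsq x by rewrite nsq_gt0.
pose k := (Num.sqrt (nsq x))^-1.
have kk : k ^+ 2 * nsq x = 1.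
  by rewrite exprVn sqr_sqrtr ?nsq_ge0 // mulVf // gt_eqF.
have : vnorm ab2 (A *m (emb k *: x)) <= N A.
  apply: sup_upper_bound => //; exists (emb k *: x) => //=.
  by rewrite /vnorm -/(nsq _) nsqZ ab2_emb kk sqrtr1.
rewrite -(ler_pXn2r (ltn0Sn 1)) ?nnegrE ?sqrtr_ge0 // sqr_sqrtr ?nsq_ge0 //.
rewrite -scalemxAr -/(nsq _) nsqZ ab2_emb => h.
have := ler_wpM2r (ltW p0) h; apply: le_trans.
by rewrite mulrAC kk mul1r.
Qed.

Lemma specnorm_ge0 n (A : 'M[F]_n.+1) : 0 <= N A.
Proof. by have [] := specnorm_least A. Qed.

Lemma specnorm_opbound n (A : 'M[F]_n.+1) : opbound A (N A ^+ 2).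
Proof. by have [] := specnorm_least A. Qed.

Lemma specnorm_eigen n (A : 'M[F]_n.+1) :
  exists2 x : 'cV[F]_n.+1, x != 0 & adj A *m (A *m x) = emb (N A ^+ 2) *: x.
Proof. by have [_ h1 h2] := specnorm_least A; apply: least_opbound_eigen. Qed.

Lemma specnorm_uniq n (A : 'M[F]_n.+1) t (x : 'cV[F]_n.+1) :
  0 <= t -> opbound A (t ^+ 2) -> x != 0 -> nsq (A *m x) = t ^+ 2 * nsq x ->
  N A = t.
Proof.
move=> t0 hA x0 e; have [N0 h1 h2] := specnorm_least A.
apply: (@pexpIrn _ 2); rewrite ?nnegrE //.
apply/eqP; rewrite eq_le h2 //=.
by have := h1 x; rewrite e ler_pM2r // nsq_gt0.
Qed.

Lemma specnorm_opbound_adj n (A : 'M[F]_n.+1) : opbound (adj A) (N A ^+ 2).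
Proof.
have [->|A0] := eqVneq A 0.
  by move=> x; rewrite adj0 mul0mx nsq0 mulr_ge0 ?sqr_ge0 ?nsq_ge0.
apply: opbound_adj; last exact: specnorm_opbound.
rewrite lt_neqAle sqr_ge0 andbT; apply: contra A0 => /eqP s0.
apply/eqP/matrixP => i j; rewrite mxE; have := specnorm_opbound A (delta_mx j 0).
rewrite -s0 mul0r => h; have : nsq (A *m delta_mx j 0) == 0 by rewrite eq_le h nsq_ge0.
by rewrite nsq_eq0 -colE => /eqP /colP /(_ i); rewrite !mxE.
Qed.

(* The left singular vectors of A for the singular value |A|. *)
Definition top n (A : 'M[F]_n.+1) (u : 'cV[F]_n.+1) :=
  A *m (adj A *m u) = emb (N A ^+ 2) *: u.

(** If x is an eigenvector of A^* A, then A x is one of A A^* for the same eigenvalue. If A x = 0,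
    then |A| = 0 and x itself qualifies. *)
Lemma top_ex n (A : 'M[F]_n.+1) : exists2 u, u != 0 & top A u.
Proof.
have [x x0 hx] := specnorm_eigen A.
have [Ax0|Ax0] := eqVneq (A *m x) 0; last first.
  by exists (A *m x) => //; rewrite /top hx -scalemxAr.
exists x => //; have N0 : N A ^+ 2 = 0.
  move: hx; rewrite Ax0 mulmx0 => /esym/eqP.
  by rewrite scaler_eq0 (negbTE x0) orbF fmorph_eq0 => /eqP.
have := specnorm_opbound_adj A x; rewrite N0 mul0r => h.
have : nsq (adj A *m x) == 0 by rewrite eq_le h nsq_ge0.
by rewrite /top N0 rmorph0 scale0r nsq_eq0 => /eqP ->; rewrite mulmx0.
Qed.

Lemma top_nsq n (A : 'M[F]_n.+1) u : top A u -> nsq (adj A *m u) = N A ^+ 2 * nsq u.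
Proof. by move=> h; apply: eigen_nsq; rewrite adjK. Qed.

Lemma nsq_top n (A : 'M[F]_n.+1) u : nsq (adj A *m u) = N A ^+ 2 * nsq u -> top A u.
Proof.
move=> /(opbound_eigen (sqr_ge0 _) (@specnorm_opbound_adj _ A)).
by rewrite adjK.
Qed.

Lemma specnorm_adj n (A : 'M[F]_n.+1) : N (adj A) = N A.
Proof.
have [u u0 hu] := top_ex A.
apply: (specnorm_uniq (specnorm_ge0 A) (@specnorm_opbound_adj _ A) u0).
exact: top_nsq.
Qed.

(** The vector A^* u attains the bound, as |A A^* u|^2 = t^4 |u|^2 = t^2 |A^* u|^2; for t = 0 it
    vanishes and u takes its place. *)
Lemma top_intro n (A : 'M[F]_n.+1) u t : 0 <= t -> u != 0 -> opbound A (t ^+ 2) ->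
  A *m (adj A *m u) = emb (t ^+ 2) *: u -> N A = t /\ top A u.
Proof.
move=> t0 u0 hA e; suff NA : N A = t by rewrite /top NA.
have e1 : nsq (adj A *m u) = t ^+ 2 * nsq u by apply: eigen_nsq; rewrite adjK.
have [tz|tp] := eqVneq t 0.
  apply: (specnorm_uniq t0 hA u0); apply/eqP; rewrite eq_le hA /=.
  by rewrite tz expr0n mul0r nsq_ge0.
apply: (@specnorm_uniq _ _ _ (adj A *m u) t0 hA); last first.
  by rewrite e nsqZ ab2_emb e1; ring.
by rewrite -nsq_eq0 e1 mulf_neq0 ?sqrf_eq0 ?nsq_eq0.
Qed.

(** In |A^* B x| <= |A| |B x| <= |A| |B| |x| a maximizing x forces two equalities, which make B x a
    common top vector. Conversely, A^* B attains |A| |B| at B^* u. *)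
Lemma norm_mult_top n (A B : 'M[F]_n.+1) :
  N (adj A *m B) = N A * N B <-> exists u, [/\ u != 0, top A u & top B u].
Proof.
have bound (x : 'cV[F]_n.+1) : nsq (adj A *m (B *m x)) <= N A ^+ 2 * nsq (B *m x).
  exact: specnorm_opbound_adj.
have bound2 (x : 'cV[F]_n.+1) : N A ^+ 2 * nsq (B *m x) <= N A ^+ 2 * (N B ^+ 2 * nsq x).
  by apply: ler_wpM2l; [exact: sqr_ge0 | exact: specnorm_opbound].
split=> [e|[u [u0 hA hB]]].
  (* If a factor has norm 0, every vector is top for it, so any top vector of the other is
     common. *)
  have [NA|NA] := eqVneq (N A) 0.
    have [u u0 hu] := top_ex B; exists u; split => //; apply: nsq_top.
    apply/eqP; rewrite eq_le specnorm_opbound_adj /=.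
    by rewrite NA expr0n mul0r nsq_ge0.
  have [NB|NB] := eqVneq (N B) 0.
    have [u u0 hu] := top_ex A; exists u; split => //; apply: nsq_top.
    apply/eqP; rewrite eq_le specnorm_opbound_adj /=.
    by rewrite NB expr0n mul0r nsq_ge0.
  have [x x0 hx] := specnorm_eigen (adj A *m B).
  have {}hx := eigen_nsq hx; rewrite e exprMn -!mulmxA in hx.
  have NA0 : 0 < N A ^+ 2 by rewrite exprn_gt0 // lt_neqAle eq_sym NA specnorm_ge0.
  have hB : nsq (B *m x) = N B ^+ 2 * nsq x.
    apply/eqP; rewrite eq_le specnorm_opbound /=.
    by have := bound x; rewrite hx -mulrA ler_pM2l.
  exists (B *m x); split.
  - by rewrite -nsq_eq0 hB mulf_neq0 ?sqrf_eq0 ?nsq_eq0.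
  - by apply: nsq_top; rewrite hx hB mulrA.
  - rewrite /top (opbound_eigen (sqr_ge0 _) (@specnorm_opbound _ B) hB).
    by rewrite -scalemxAr.
have hAB : opbound (adj A *m B) ((N A * N B) ^+ 2).
  by move=> x; rewrite exprMn -mulrA -mulmxA; apply: le_trans (bound x) (bound2 x).
have NAB : 0 <= N A * N B by rewrite mulr_ge0 ?specnorm_ge0.
have [NB|NB] := eqVneq (N B) 0.
  apply: (specnorm_uniq NAB hAB u0); apply/eqP; rewrite eq_le hAB /=.
  by rewrite NB mulr0 expr0n mul0r nsq_ge0.
apply: (@specnorm_uniq _ _ _ (adj B *m u) NAB hAB).
  by rewrite -nsq_eq0 (top_nsq hB) mulf_neq0 ?sqrf_eq0 ?nsq_eq0.
rewrite -mulmxA hB -scalemxAr nsqZ ab2_emb (top_nsq hA) (top_nsq hB).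
ring.
Qed.

(** * Transfer of eigenvectors *)

Lemma mul_col_mx11 n (x : 'cV[F]_n) (k : 'M[F]_1) : x *m k = k 0 0 *: x.
Proof. by rewrite {1}[k]mx11_scalar mul_mx_scalar. Qed.

Lemma nsqD_orth n (a b : 'cV[F]_n) : adj a *m b = 0 -> nsq (a + b) = nsq a + nsq b.
Proof.
move=> ab; apply: nsq_inj1; rewrite adjD mulmxDl !mulmxDr !adj_mul_self ab addr0.
by rewrite (adj_mul_eq0C ab) add0r rmorphD raddfD.
Qed.

(** The matrix maps w to a multiple of u and the complement of w into that of u. Its squared norm is
    the larger of |u|^2 |w|^2 and t^2 |C|^2, and the former wins for small t. *)
Lemma top_perturb n (u w : 'cV[F]_n.+1) (C : 'M[F]_n.+1) :
  u != 0 -> w != 0 -> adj u *m C = 0 -> C *m w = 0 ->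
  exists2 d, 0 < d & forall t, t ^+ 2 <= d -> top (u *m adj w + emb t *: C) u.
Proof.
move=> u0 w0 uC Cw; have [c c0 hc] := opbound_ex C.
have p0 : 0 < nsq u by rewrite nsq_gt0.
have q0 : 0 < nsq w by rewrite nsq_gt0.
exists (nsq u * nsq w / c); first by rewrite divr_gt0 ?mulr_gt0.
move=> t ht; have {}ht : t ^+ 2 * c <= nsq u * nsq w by rewrite -ler_pdivlMr.
set B := _ + _.
have s2 : Num.sqrt (nsq u * nsq w) ^+ 2 = nsq u * nsq w.
  by rewrite sqr_sqrtr // mulr_ge0 ?nsq_ge0.
apply: (proj2 (@top_intro _ _ _ (Num.sqrt (nsq u * nsq w)) (sqrtr_ge0 _) u0 _ _)); rewrite s2.
  move=> z; pose a := (adj w *m z) 0 0 / emb (nsq w); pose z' := z - a *: w.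
  have wz : adj w *m z = (a * emb (nsq w))%:M.
    by rewrite [LHS]mx11_scalar divfK // fmorph_eq0 gt_eqF.
  have wz' : adj w *m z' = 0.
    by rewrite mulmxBr wz -scalemxAr adj_mul_self scale_scalar_mx subrr.
  have ez : z = a *: w + z' by rewrite addrC subrK.
  have nz : nsq z = ab2 a * nsq w + nsq z'.
    by rewrite ez nsqD_orth ?nsqZ // adjZ -scalemxAl wz' scaler0.
  have -> : B *m z = (a * emb (nsq w)) *: u + emb t *: (C *m z').
    rewrite mulmxDl -mulmxA wz mul_mx_scalar -scalemxAl.
    by rewrite mulmxBr -scalemxAr Cw scaler0 subr0.
  rewrite nsqD_orth; last first.
    by rewrite adjZ -scalemxAl -scalemxAr mulmxA uC mul0mx !scaler0.
  rewrite !nsqZ ab2M !ab2_emb nz mulrDr lerD //.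
    by rewrite le_eqVlt; apply/orP; left; apply/eqP; ring.
  have := hc z'; have := nsq_ge0 z'; have := sqr_ge0 t; nra.
have Bu : adj B *m u = emb (nsq u) *: w.
  rewrite adjD adjM adjK adjZ mulmxDl -mulmxA adj_mul_self mul_mx_scalar.
  by rewrite -scalemxAl (adj_mul_eq0C uC) scaler0 addr0.
rewrite Bu -scalemxAr mulmxDl -mulmxA adj_mul_self mul_mx_scalar -scalemxAl Cw scaler0 addr0.
by rewrite scalerA -rmorphM.
Qed.

Lemma top_rank1 n (x z : 'cV[F]_n.+1) : x != 0 -> z != 0 ->
  top (x *m adj x) z -> exists2 c, c != 0 & z = c *: x.
Proof.
move=> x0 z0; rewrite /top -!mulmxA mul_col_mx11; set k := (_ *m _) 0 0 => h.
have N0 : emb (N (x *m adj x) ^+ 2) != 0.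
  rewrite fmorph_eq0; apply/eqP => N0.
  have := specnorm_opbound (x *m adj x) x; rewrite N0 mul0r -mulmxA adj_mul_self.
  rewrite mul_mx_scalar nsqZ ab2_emb leNgt mulr_gt0 ?exprn_gt0 ?nsq_gt0 //.
exists (k / emb (N (x *m adj x) ^+ 2)); last first.
  by rewrite mulrC -scalerA h scalerA mulVf // scale1r.
apply: contra z0 => /eqP; move/(canRL (divfK N0)); rewrite mul0r => k0.
move: h; rewrite k0 scale0r => /esym/eqP.
by rewrite scaler_eq0 (negbTE N0).
Qed.

Lemma cond_i_top n (T : 'M[F]_n.+1 -> 'M[F]_n.+1) :
  (forall B, exists A, T A = B) -> cond_i cj ab2 T ->
  forall x, x != 0 -> exists2 u, u != 0 & forall B, top B u -> top (T B) x.
Proof.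
move=> sT hT x x0; have [A TA] := sT (x *m adj x).
have [u u0 hu] := top_ex A; exists u => // B hB.
have /hT : N (adj A *m B) = N A * N B by apply/norm_mult_top; exists u.
move=> /norm_mult_top [z [z0]]; rewrite TA => /(top_rank1 x0 z0) [c c0 ->].
rewrite /top -!scalemxAr !scalerA [_ * c]mulrC -scalerA.
by apply: scalerI.
Qed.

Lemma mx11_double0 (f : 'M[F]_1) : f + f = 0 -> f = 0.
Proof.
rewrite -mulr2n -scaler_nat => /eqP; rewrite scaler_eq0.
rewrite -(rmorph_nat emb) fmorph_eq0 pnatr_eq0 => /= /eqP //.
Qed.

(** Compares the values at t = 0 and at the two square roots of d. *)
Lemma quadratic_coef0 (P0 P1 P2 : 'M[F]_1) (d : R) : 0 < d ->
  (forall t, t ^+ 2 <= d -> P0 + emb t *: P1 + emb (t ^+ 2) *: P2 = 0) ->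
  [/\ P0 = 0, P1 = 0 & P2 = 0].
Proof.
move=> d0 h.
have e0 : P0 = 0 by have := h 0; rewrite expr0n /= (rmorph0 emb) !scale0r !addr0; apply; exact: ltW.
have s0 : emb (Num.sqrt d) != 0 by rewrite fmorph_eq0 gt_eqF // sqrtr_gt0.
have d0' : emb d != 0 by rewrite fmorph_eq0 gt_eqF.
have sd : Num.sqrt d ^+ 2 = d by rewrite sqr_sqrtr ?ltW.
have := h (Num.sqrt d); have := h (- Num.sqrt d).
rewrite sqrrN sd e0 !add0r rmorphN scaleNr => /(_ (lexx _)) h1 /(_ (lexx _)) h2.
have e2 : P2 = 0.
  have : emb d *: P2 + emb d *: P2 = 0.
    by rewrite -[RHS](addr0 0) -{1}h1 -h2 addrACA addNr add0r.
  by move/mx11_double0/eqP; rewrite scaler_eq0 (negbTE d0') => /eqP.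
split=> //; move: h2; rewrite e2 scaler0 addr0 => /eqP.
by rewrite scaler_eq0 (negbTE s0) => /eqP.
Qed.

(** Splits A as u w^* + C with w = A^* u / |u|^2: the first term carries all of u^* A, so u^* kills
    the rest. *)
Lemma outer_split n (u : 'cV[F]_n) (A : 'M[F]_n) : u != 0 ->
  adj u *m (A - u *m adj ((emb (nsq u))^-1 *: (adj A *m u))) = 0.
Proof.
move=> u0; have p0 : emb (nsq u) != 0 by rewrite fmorph_eq0 nsq_eq0.
rewrite mulmxBr mulmxA adj_mul_self mul_scalar_mx adjZ scalerA fmorphV cj_emb.
by rewrite mulfV // scale1r adjM adjK subrr.
Qed.

Section Transfer.
Variables (n : nat) (T : 'M[F]_n.+1 -> 'M[F]_n.+1) (u x y : 'cV[F]_n.+1).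
Hypothesis TD : forall A B, T (A + B) = T A + T B.
Hypothesis TZ : forall r A, T (emb r *: A) = emb r *: T A.
Hypothesis u0 : u != 0.
Hypothesis Tux : forall B, top B u -> top (T B) x.
Hypothesis yx : adj y *m x = 0.

(** Polarizes y^* T(A) T(A)^* x. As T is only real-linear, G is bilinear over the reals only. *)
Let G A B := adj y *m (T A *m (adj (T B) *m x)).

Lemma gramDl A B C : G (A + B) C = G A C + G B C.
Proof. by rewrite /G TD mulmxDl mulmxDr. Qed.

Lemma gramDr A B C : G C (A + B) = G C A + G C B.
Proof. by rewrite /G TD adjD mulmxDl !mulmxDr. Qed.

Lemma gramZl r A B : G (emb r *: A) B = emb r *: G A B.
Proof. by rewrite /G TZ -scalemxAl -scalemxAr. Qed.

Lemma gramZr r A B : G A (emb r *: B) = emb r *: G A B.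
Proof. by rewrite /G TZ adjZ cj_emb -scalemxAl -!scalemxAr. Qed.

Lemma top_gram B : top B u -> G B B = 0.
Proof. by move=> /Tux h; rewrite /G h -scalemxAr yx scaler0. Qed.

(** The form vanishes at u w^* + t C for all small t, where it is a quadratic polynomial in t. *)
Lemma perturb_gram (w : 'cV[F]_n.+1) C : w != 0 -> adj u *m C = 0 -> C *m w = 0 ->
  [/\ G (u *m adj w) (u *m adj w) = 0, G (u *m adj w) C + G C (u *m adj w) = 0 & G C C = 0].
Proof.
move=> w0 uC Cw; have [d d0 hd] := top_perturb u0 w0 uC Cw.
apply: (quadratic_coef0 d0) => t /hd /top_gram.
rewrite gramDl !gramDr !gramZl !gramZr scalerA -expr2 -rmorphXn => <-.
by rewrite scalerDr !addrA.
Qed.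

(** Passes from the largest eigenvalue to any c. For A = u w'^* + C the eigenvector equation yields
    C w' = 0, and the coefficients in [perturb_gram] add up to G A A. *)
Lemma eigen_gram A c : A *m (adj A *m u) = c *: u -> G A A = 0.
Proof.
move=> hA; have p0 : nsq u != 0 by rewrite nsq_eq0.
have ep0 : emb (nsq u) != 0 by rewrite fmorph_eq0.
pose w := adj A *m u; pose w' := (emb (nsq u))^-1 *: w; pose C := A - u *m adj w'.
have uC : adj u *m C = 0 := outer_split A u0.
have eA : A = u *m adj w' + C by rewrite addrC subrK.
have [w0|w0] := eqVneq w 0.
  (* Here A = C, which is singular because u^* C = 0; a kernel vector of C replaces w'. *)
  have [v v0 Cv] : exists2 v : 'cV[F]_n.+1, v != 0 & C *m v = 0.
    have : \det C^T == 0.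
      rewrite det_tr; apply/det0P; exists (adj u) => //.
      by apply: contra u0 => /eqP h; rewrite -[u]adjK h adj0.
    move=> /det0P [v v0 h]; exists v^T; first by rewrite -trmx0 (inj_eq trmx_inj).
    by apply: trmx_inj; rewrite trmx_mul trmxK h trmx0.
  have [_ _] := perturb_gram v0 uC Cv.
  by have -> : C = A by rewrite eA /w' w0 scaler0 adj0 mulmx0 add0r.
have w'0 : w' != 0 by rewrite scaler_eq0 invr_eq0 negb_or ep0.
have Cw : C *m w' = 0.
  have ww : adj w *m w = (c * emb (nsq u))%:M.
    by rewrite adjM adjK -mulmxA hA -scalemxAr adj_mul_self scale_scalar_mx.
  rewrite -scalemxAr mulmxBl hA -mulmxA adjZ -scalemxAl ww fmorphV cj_emb.
  by rewrite scale_scalar_mx mul_mx_scalar mulrC mulfK // subrr scaler0.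
have [h1 h2 h3] := perturb_gram w'0 uC Cw; clearbody C.
by rewrite eA gramDl !gramDr h1 h3 add0r addr0.
Qed.

End Transfer.

Lemma adj_eq0 m n (A : 'M[F]_(m, n)) : (adj A == 0) = (A == 0).
Proof.
by apply/eqP/eqP => [h|->]; [rewrite -[A]adjK h adj0 | exact: adj0].
Qed.

Lemma orth_ex n k (M : 'M[F]_(n, k)) : (k < n)%N ->
  exists2 v : 'cV[F]_n, v != 0 & adj v *m M = 0.
Proof.
move=> kn; pose v := nz_row (kermx M).
have v0 : v != 0.
  rewrite nz_row_eq0 -mxrank_eq0 mxrank_ker subn_eq0 -ltnNge.
  exact: leq_ltn_trans (rank_leq_col M) kn.
exists (adj v); first by rewrite adj_eq0.
by rewrite adjK; apply/sub_kermxP/nz_row_sub.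
Qed.

(** * Transfer of left kernels *)

Section QuadraticVanishing.
Variables (n : nat) (u : 'cV[F]_n.+2) (g : 'M[F]_n.+2 -> 'M[F]_n.+2 -> 'M[F]_1).
Hypothesis u0 : u != 0.
Hypothesis gD : forall A B C, g (A + B) C = g A C + g B C.
Hypothesis gC : forall A B, g A B = g B A.
Hypothesis g_eigen : forall A c, A *m (adj A *m u) = c *: u -> g A A = 0.

Lemma polarDr A B C : g C (A + B) = g C A + g C B.
Proof. by rewrite gC gD !(gC C). Qed.

Lemma polar0 C : g 0 C = 0.
Proof. exact: (additive_map0 (fun A B => gD A B C)). Qed.

Lemma polarN A C : g (- A) C = - g A C.
Proof. by apply/eqP; rewrite -addr_eq0 -gD addNr polar0. Qed.

Lemma polar_annihil C : adj u *m C = 0 -> g C C = 0.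
Proof. by move=> h; apply: (@g_eigen _ 0); rewrite (adj_mul_eq0C h) mulmx0 scale0r. Qed.

Lemma polar_annihil2 C D : adj u *m C = 0 -> adj u *m D = 0 -> g C D = 0.
Proof.
move=> hC hD; have := polar_annihil (C := C + D).
rewrite mulmxDr hC hD addr0 => /(_ erefl); rewrite gD !polarDr !polar_annihil //.
by rewrite add0r addr0 [g D C]gC; apply: mx11_double0.
Qed.

Lemma outer_eigen (w : 'cV[F]_n.+2) :
  (u *m adj w) *m (adj (u *m adj w) *m u) = emb (nsq w * nsq u) *: u.
Proof.
rewrite adjM adjK -!mulmxA adj_mul_self mul_mx_scalar -scalemxAr adj_mul_self.
by rewrite scale_scalar_mx mul_mx_scalar -rmorphM mulrC.
Qed.

(** u is an eigenvector of M M^* for M = u w^*, for M = C and for their sum, so the mixed term of g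
    vanishes. *)
Lemma polar_outer_annihil w C : adj u *m C = 0 -> C *m w = 0 -> g (u *m adj w) C = 0.
Proof.
move=> uC Cw.
have h1 := g_eigen (outer_eigen w); have h2 := polar_annihil uC.
have : g (u *m adj w + C) (u *m adj w + C) = 0.
  apply: (@g_eigen _ (emb (nsq w * nsq u))).
  rewrite adjD [_ *m u]mulmxDl (adj_mul_eq0C uC) addr0 mulmxDl outer_eigen.
  rewrite adjM adjK -mulmxA adj_mul_self mul_mx_scalar -scalemxAr Cw scaler0.
  by rewrite addr0.
rewrite gD !polarDr h1 h2 add0r addr0 [g C _]gC; exact: mx11_double0.
Qed.

(** An element of the radical of g; in the application it is [S (z *m adj v)] with z orthogonal to x
    and y. *)
Variable A0 : 'M[F]_n.+2.
Hypothesis gA0 : forall B, g A0 B = 0.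
Hypothesis A0u : adj A0 *m u != 0.

(* For u^* C = 0 the value depends only on the vector C w; since two independent vectors can be given the same image, it does not depend on w either, and it vanishes for w proportional to A0^* u. *)
Lemma polar_outer w C : adj u *m C = 0 -> g (u *m adj w) C = 0.
Proof.
pose w0 := (emb (nsq u))^-1 *: (adj A0 *m u).
have w00 : w0 != 0 by rewrite scaler_eq0 invr_eq0 fmorph_eq0 nsq_eq0 negb_or u0.
have ew0 : emb (nsq w0) != 0 by rewrite fmorph_eq0 nsq_eq0.
(* [A0] and u w0^* differ by a matrix that u^* kills, and g vanishes on pairs of such matrices. *)
have g0 D : adj u *m D = 0 -> g (u *m adj w0) D = 0.
  move=> uD; have -> : u *m adj w0 = A0 - (A0 - u *m adj w0) by rewrite opprB addrC subrK.
  by rewrite gD gA0 polarN (polar_annihil2 (outer_split A0 u0) uD) oppr0 addr0.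
have step a w1 D : w1 != 0 -> adj w0 *m w1 = 0 -> adj u *m D = 0 ->
    g (u *m adj (a *: w0 + w1)) D = 0.
  move=> w10 w01 uD; set v := _ + _.
  have ew1 : emb (nsq w1) != 0 by rewrite fmorph_eq0 nsq_eq0.
  (* The row l is 1 on both w0 and v, since a + (1 - a) = 1; hence D' agrees with D at v and kills v
     - w0. *)
  pose l := (emb (nsq w0))^-1 *: adj w0 + ((1 - a) / emb (nsq w1)) *: adj w1.
  have lw0 : l *m w0 = 1%:M.
    rewrite mulmxDl -!scalemxAl adj_mul_self scale_scalar_mx mulVf //.
    by rewrite (adj_mul_eq0C w01) scaler0 addr0.
  have lw1 : l *m w1 = (1 - a)%:M.
    rewrite mulmxDl -!scalemxAl adj_mul_self scale_scalar_mx w01 scaler0 add0r.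
    by rewrite divfK.
  have lv : l *m v = 1%:M.
    rewrite mulmxDr -scalemxAr lw0 lw1 scale_scalar_mx mulr1 -raddfD /=.
    by rewrite addrC subrK.
  pose D' := (D *m v) *m l.
  have uD' : adj u *m D' = 0 by rewrite !mulmxA uD !mul0mx.
  have e1 : g (u *m adj v) (D - D') = 0.
    apply: polar_outer_annihil; first by rewrite mulmxBr uD uD' subrr.
    by rewrite mulmxBl -mulmxA lv mulmx1 subrr.
  have e2 : g (u *m adj (v - w0)) D' = 0.
    apply: polar_outer_annihil => //.
    by rewrite -mulmxA mulmxBr lv lw0 subrr mulmx0.
  rewrite -(subrK D' D) polarDr e1 add0r -(subrK w0 v) adjD mulmxDr gD e2 add0r.
  exact: g0.
move=> uC; pose a := (adj w0 *m w) 0 0 / emb (nsq w0); pose w' := w - a *: w0.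
have ow' : adj w0 *m w' = 0.
  rewrite mulmxBr -scalemxAr adj_mul_self scale_scalar_mx divfK //.
  by rewrite -mx11_scalar subrr.
have ew : w = a *: w0 + w' by rewrite addrC subrK.
have [w'0|w'0] := eqVneq w' 0; last by rewrite ew; apply: step.
(* A multiple of w0 is a sum of two vectors with nonzero component orthogonal to w0. *)
have [w1 w10 hw1] := @orth_ex n.+2 1 w0 isT.
have w01 := adj_mul_eq0C hw1.
have -> : w = (a *: w0 + w1) + (0 *: w0 - w1).
  by rewrite scale0r sub0r addrK ew w'0 addr0.
rewrite adjD mulmxDr gD !step ?addr0 ?oppr_eq0 //.
by rewrite mulmxN w01 oppr0.
Qed.

Lemma quadratic_vanishing A : g A A = 0.
Proof.
pose w := (emb (nsq u))^-1 *: (adj A *m u).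
have hC := outer_split A u0; rewrite -/w in hC.
have -> : A = u *m adj w + (A - u *m adj w) by rewrite addrC subrK.
move: (A - _) hC => C uC.
rewrite gD !polarDr (gC C (_ *m _)) (polar_outer w uC) (polar_annihil uC) !addr0.
exact: g_eigen (outer_eigen w).
Qed.

End QuadraticVanishing.

Section KernelTransfer.
Variables (n : nat) (T S : 'M[F]_n.+3 -> 'M[F]_n.+3).
Hypothesis TD : forall A B, T (A + B) = T A + T B.
Hypothesis TZ : forall r A, T (emb r *: A) = emb r *: T A.
Hypothesis SD : forall A B, S (A + B) = S A + S B.
Hypothesis SK : cancel S T.

(** If the claim failed for B = z v^*, then S B would lie in the radical of g, formed with y
    orthogonal to x and z. So g would vanish identically, which a test matrix refutes. *)
Lemma kernel_transfer u x : u != 0 -> x != 0 -> (forall B, top B u -> top (T B) x) ->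
  forall B, adj x *m B = 0 -> adj u *m S B = 0.
Proof.
move=> u0 x0 Tux; pose Q (B : 'M[F]_n.+3) := adj u *m S B = 0.
have S0 := additive_map0 SD.
have QD B C : Q B -> Q C -> Q (B + C) by rewrite /Q SD mulmxDr => -> ->; rewrite addr0.
have Q0 : Q 0 by rewrite /Q S0 mulmx0.
suff rank1 (z v : 'cV[F]_n.+3) : adj x *m z = 0 -> Q (z *m adj v).
  move=> B xB; have -> : B = \sum_j col j B *m adj (delta_mx j 0).
    apply/matrixP => i k; rewrite summxE (bigD1 k) //= big1 => [|j jk].
      by rewrite mxE big_ord1 !mxE !eqxx rmorph1 mulr1 addr0.
    by rewrite mxE big_ord1 !mxE eq_sym (negbTE jk) rmorph0 mulr0.
  by apply: (big_ind Q) => // j _; apply: rank1; rewrite colE mulmxA xB mul0mx.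
move=> xz; apply/eqP; rewrite -adj_eq0 adjM adjK; apply/negPn/negP => Su.
(* The size enters here: two columns cannot span a space of dimension at least 3. *)
have [y y0] := @orth_ex n.+3 (1 + 1) (row_mx x z) isT.
rewrite mul_mx_row -[0]hsubmxK => /eq_row_mx [yx yz].
have {}yx : adj y *m x = 0 by rewrite yx; apply/matrixP => i j; rewrite !mxE.
have {}yz : adj y *m z = 0 by rewrite yz; apply/matrixP => i j; rewrite !mxE.
pose G A B := adj y *m (T A *m (adj (T B) *m x)).
pose g A B := G A B + G B A.
have GDl A B C : G (A + B) C = G A C + G B C by exact: gramDl.
have GDr A B C : G C (A + B) = G C A + G C B by exact: gramDr.
have g_van A : g A A = 0.
  apply: (@quadratic_vanishing _ u g u0 _ _ _ (S (z *m adj v))) => //.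
  - by move=> B C D; rewrite /g GDl GDr addrACA.
  - by move=> B C; rewrite /g addrC.
  - by move=> B c /(eigen_gram TD TZ u0 Tux yx) h; rewrite /g /G h addr0.
  (* y^* z = 0 kills one summand of g and z^* x = 0 the other. *)
  - move=> B; rewrite /g /G SK !adjM adjK -!mulmxA (adj_mul_eq0C xz).
    by rewrite !mulmx0 addr0 (mulmxA (adj y)) yz mul0mx.
(* At this matrix G equals |y|^2 |x|^4. *)
have := g_van (S ((x + y) *m adj x)).
move/mx11_double0; rewrite /G SK adjM adjK -!mulmxA.
have -> : adj (x + y) *m x = (emb (nsq x))%:M.
  by rewrite adjD mulmxDl yx addr0 adj_mul_self.
rewrite mul_mx_scalar -!scalemxAr adj_mul_self mul_mx_scalar -scalemxAr mulmxDr yx add0r.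
rewrite adj_mul_self => /eqP; rewrite !scaler_eq0 fmorph_eq0 nsq_eq0 (negbTE x0) /=.
move=> /eqP /matrixP /(_ 0 0) /eqP; rewrite !mxE eqxx mulr1n.
by rewrite fmorph_eq0 nsq_eq0 (negbTE y0).
Qed.

End KernelTransfer.

(** * Maps sending left kernels into left kernels *)

(** Source of the two alternatives in (iii): the twist of the semilinear row maps is such an
    endomorphism. *)
Hypothesis real_endo : forall th : F -> F,
  (forall a b, th (a + b) = th a + th b) -> (forall a b, th (a * b) = th a * th b) ->
  (forall r, th (emb r) = emb r) -> th =1 id \/ th =1 cj.

Section RowStructure.
Variables (n : nat) (S : 'M[F]_n.+2 -> 'M[F]_n.+2).
Hypothesis SD : forall A B, S (A + B) = S A + S B.
Hypothesis SZ : forall r A, S (emb r *: A) = emb r *: S A.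
Hypothesis S_inj : injective S.
Hypothesis S_surj : forall A, exists B, S B = A.
Hypothesis S_ker : forall xi : 'rV[F]_n.+2, xi != 0 ->
  exists2 eta : 'rV[F]_n.+2, eta != 0 & forall B, xi *m B = 0 -> eta *m S B = 0.

Local Notation e_ := (fun i : 'I_n.+2 => delta_mx i 0 : 'cV[F]_n.+2).
Local Notation f_ := (fun i : 'I_n.+2 => delta_mx 0 i : 'rV[F]_n.+2).

Lemma delta_row_neq0 i : f_ i != 0.
Proof. by apply/eqP => /rowP /(_ i) /eqP; rewrite !mxE !eqxx oner_eq0. Qed.

Lemma delta_row_col i j : f_ i *m e_ j = (i == j)%:R%:M.
Proof.
apply/matrixP => a b; rewrite !ord1 mxE (bigD1 i) //= big1 => [|k ki].
  by rewrite !mxE !eqxx mul1r addr0 andbT.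
by rewrite !mxE (negbTE ki) mul0r.
Qed.

Variable eta : 'I_n.+2 -> 'rV[F]_n.+2.
Hypothesis eta0 : forall i, eta i != 0.
Hypothesis eta_ker : forall i B, f_ i *m B = 0 -> eta i *m S B = 0.

(** After left multiplication by [K], S acts on each row separately, on row i through [s i]. *)
Let s i (y : 'rV[F]_n.+2) := eta i *m S (e_ i *m y).
Let K := \matrix_i eta i.

Lemma row_map_eq i B : eta i *m S B = s i (row i B).
Proof.
rewrite /s; set C := e_ i *m _; rewrite -(subrK C B) SD mulmxDr eta_ker ?add0r //.
by rewrite mulmxBr -rowE mulmxA delta_row_col eqxx mul1mx subrr.
Qed.

Lemma row_map_out i j y : i != j -> row j (e_ i *m y) = 0 :> 'rV[F]_n.+2.
Proof.
move=> ij; rewrite rowE mulmxA delta_row_col eq_sym (negbTE ij).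
by rewrite mul_scalar_mx scale0r.
Qed.

Lemma row_map0 i : s i 0 = 0.
Proof. by rewrite /s mulmx0 (additive_map0 SD) mulmx0. Qed.

Lemma row_mapD i y z : s i (y + z) = s i y + s i z.
Proof. by rewrite /s mulmxDr SD mulmxDr. Qed.

Lemma row_mapZ i r y : s i (emb r *: y) = emb r *: s i y.
Proof. by rewrite /s -scalemxAr SZ -scalemxAr. Qed.

Lemma comb_outer (c : 'rV[F]_n.+2) i y : c *m K *m S (e_ i *m y) = c 0 i *: s i y.
Proof.
rewrite -mulmxA mulmx_sum_row (bigD1 i) //= big1 ?addr0 => [|j ji].
  by rewrite row_mul rowK.
rewrite row_mul rowK row_map_eq row_map_out 1?eq_sym // row_map0 scaler0 //.
Qed.

(** A relation c K = 0 with c_i nonzero forces s i = 0 on all rows; then eta i S(B) = 0 even for the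
    B with S(B) = 1. *)
Lemma eta_unit : K \in unitmx.
Proof.
rewrite unitmxE unitfE; apply/negP => /det0P[c c0 cK].
have [i ci] : exists i, c 0 i != 0.
  apply/existsP; apply: contraNT c0 => /existsPn h.
  by apply/eqP/rowP => i; rewrite mxE; apply/eqP/negPn/h.
have [B SB] := S_surj 1%:M; have := eta0 i.
rewrite -[eta i]mulmx1 -SB row_map_eq.
have := comb_outer c i (row i B); rewrite cK mul0mx => /esym/eqP.
by rewrite scaler_eq0 (negbTE ci) => /eqP ->; rewrite eqxx.
Qed.

Lemma row_map_inj i y : s i y = 0 -> y = 0.
Proof.
move=> h; have : K *m S (e_ i *m y) = 0.
  apply/row_matrixP => j; rewrite row_mul rowK row0 row_map_eq.
  have [<-|ij] := eqVneq i j; first by rewrite rowE mulmxA delta_row_col eqxx mul1mx.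
  by rewrite row_map_out // row_map0.
move/(congr1 (mulmx (invmx K))); rewrite mulKmx ?eta_unit // mulmx0 -(additive_map0 SD) => /S_inj.
by move/(congr1 (mulmx (f_ i))); rewrite mulmxA delta_row_col eqxx mul1mx mulmx0.
Qed.

(** The row f_j - c f_i kills e_i y + e_j c y. The row h that [S_ker] provides is h' K with h'
    supported on i and j, and it relates s i y to s j (c y) linearly. *)
Lemma row_map_pair i j c : i != j -> exists t, forall y, s j (c *: y) = t *: s i y.
Proof.
move=> ij; have : f_ j - c *: f_ i != 0.
  apply/eqP => /(congr1 (fun v => v *m e_ j)); rewrite mulmxBl -scalemxAl !delta_row_col.
  rewrite eqxx (negbTE ij) mul0mx => /matrixP /(_ 0 0) /eqP.
  by rewrite !mxE !eqxx /= mulr0n mulr0 subr0 oner_eq0.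
move=> /S_ker [h h0 hB]; pose h' := h *m invmx K.
have eh : h = h' *m K by rewrite mulmxKV ?eta_unit.
have out k : k != i -> k != j -> h' 0 k = 0.
  move=> ki kj; have : h *m S (e_ k *m f_ k) = 0.
    apply: hB; rewrite mulmxA mulmxBl -scalemxAl !delta_row_col.
    rewrite ![_ == k]eq_sym (negbTE ki) (negbTE kj) scale_scalar_mx mulr0 subrr mul0mx //.
  rewrite eh comb_outer => /eqP; rewrite scaler_eq0 => /orP[/eqP //|/eqP].
  by move/row_map_inj/eqP; rewrite (negbTE (delta_row_neq0 k)).
have rel y : h' 0 i *: s i y + h' 0 j *: s j (c *: y) = 0.
  rewrite -!comb_outer -mulmxDr -SD -eh; apply: hB.
  rewrite mulmxDr !mulmxA !mulmxBl -!scalemxAl !delta_row_col !eqxx.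
  rewrite eq_sym (negbTE ij) !mul1mx !mul_scalar_mx !scale0r scaler0 subr0 sub0r.
  by rewrite addNr.
(* If h'_j = 0, the relation and the injectivity of s i give h'_i = 0, whence h = 0. *)
have hj0 : h' 0 j != 0.
  apply: contra h0 => /eqP hj; rewrite eh.
  suff -> : h' = 0 by rewrite mul0mx.
  apply/rowP => k; rewrite [RHS]mxE.
  have [->//|kj] := eqVneq k j; have [->|ki] := eqVneq k i; last exact: out.
  have := rel (f_ i); rewrite hj scale0r addr0 => /eqP; rewrite scaler_eq0.
  by case/orP=> [/eqP //|/eqP /row_map_inj /eqP]; rewrite (negbTE (delta_row_neq0 i)).
exists (- (h' 0 i) / h' 0 j) => y; apply: (scalerI hj0).
rewrite scalerA mulrC divfK // scaleNr; apply/eqP.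
by rewrite -addr_eq0 addrC rel.
Qed.

(** Goes from row 0 to row 1 with the scalar c and back with the scalar 1, as [row_map_pair]
    compares distinct rows. *)
Lemma row_map_semilinear c : exists t, forall y, s 0 (c *: y) = t *: s 0 y.
Proof.
have [t ht] := @row_map_pair 0 1 c isT; have [k hk] := @row_map_pair 1 0 1 isT.
exists (k * t) => y; have := hk (c *: y); rewrite scale1r => ->.
by rewrite ht scalerA.
Qed.

Lemma row_map_prop i : exists m, forall y, s i y = m *: s 0 y.
Proof.
have [->|i0] := eqVneq i 0; first by exists 1 => y; rewrite scale1r.
have [|t ht] := @row_map_pair 0 i 1; first by rewrite eq_sym.
by exists t => y; rewrite -ht scale1r.
Qed.

(** Semilinearity of s 0 defines a ring endomorphism th fixing the reals, with s 0 y = th(y) Q. Each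
    s i is a multiple of s 0, so K S(B) = diag(m) th(B) Q. *)
Lemma row_structure_aux :
  exists M Q, (forall B, S B = M *m B *m Q) \/ (forall B, S B = M *m cmx cj B *m Q).
Proof.
have z0 : s 0 (f_ 0) != 0.
  by apply/eqP => /row_map_inj /eqP; rewrite (negbTE (delta_row_neq0 0)).
have [k zk] : exists k, s 0 (f_ 0) 0 k != 0.
  apply/existsP; apply: contraNT z0 => /existsPn h.
  by apply/eqP/rowP => i; rewrite [RHS]mxE; apply/eqP/negPn/h.
(* The factor is read off at a coordinate k where s 0 f_0 is nonzero. *)
pose th c := s 0 (c *: f_ 0) 0 k / s 0 (f_ 0) 0 k.
have thE c y : s 0 (c *: y) = th c *: s 0 y.
  have [t ht] := row_map_semilinear c; rewrite ht; congr (_ *: _).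
  by rewrite /th ht mxE mulfK.
have thD a b : th (a + b) = th a + th b.
  by rewrite /th scalerDl row_mapD mxE mulrDl.
have thM a b : th (a * b) = th a * th b.
  by rewrite {1}/th -scalerA thE mxE -mulrA.
have th_emb r : th (emb r) = emb r by rewrite /th row_mapZ mxE mulfK.
have [m hm] := fin_all_exists row_map_prop.
pose Q := \matrix_i s 0 (f_ i).
have rowE0 y : s 0 y = map_mx th y *m Q.
  rewrite mulmx_sum_row {1}[y]row_sum_delta.
  have -> : s 0 (\sum_j y 0 j *: f_ j) = \sum_j s 0 (y 0 j *: f_ j).
    by apply: (big_morph (s 0) (row_mapD 0) (row_map0 0)).
  by apply: eq_bigr => j _; rewrite thE rowK mxE.
have KS B : K *m S B = diag_mx (\row_i m i) *m (map_mx th B *m Q).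
  apply/row_matrixP => i; rewrite row_mul rowK row_map_eq hm rowE0.
  rewrite row_mul row_diag_mx -scalemxAl -rowE mxE row_mul; congr (_ *: (_ *m _)).
  by apply/rowP => j; rewrite !mxE.
have SE B : S B = invmx K *m diag_mx (\row_i m i) *m map_mx th B *m Q.
  by rewrite -!mulmxA -KS mulKmx ?eta_unit.
exists (invmx K *m diag_mx (\row_i m i)), Q.
by case: (real_endo thD thM th_emb) => h; [left|right] => B; rewrite SE;
  congr (_ *m _ *m _); apply/matrixP => i j; rewrite !mxE h.
Qed.

End RowStructure.

Lemma row_structure n (S : 'M[F]_n.+2 -> 'M[F]_n.+2) :
  (forall A B, S (A + B) = S A + S B) ->
  (forall r A, S (emb r *: A) = emb r *: S A) ->
  injective S -> (forall A, exists B, S B = A) ->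
  (forall xi : 'rV[F]_n.+2, xi != 0 ->
    exists2 eta : 'rV[F]_n.+2, eta != 0 & forall B, xi *m B = 0 -> eta *m S B = 0) ->
  exists M Q, (forall B, S B = M *m B *m Q) \/ (forall B, S B = M *m cmx cj B *m Q).
Proof.
move=> SD SZ Si Ss Sk.
have /fin_all_exists2 [eta e0 ek] : forall i : 'I_n.+2, exists2 eta : 'rV[F]_n.+2,
    eta != 0 & forall B, (delta_mx 0 i : 'rV_n.+2) *m B = 0 -> eta *m S B = 0.
  by move=> i; apply: Sk; apply: delta_row_neq0.
exact: (row_structure_aux SD SZ Si Ss Sk e0 ek).
Qed.

(** * Unitary normalization *)

(** Pairs of basis vectors kill the off-diagonal entries; e_i + e_0 against e_i - e_0 compares H i i
    with H 0 0. *)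
Lemma orth_scalar n (H : 'M[F]_n.+1) :
  (forall x y : 'cV[F]_n.+1, x != 0 -> adj y *m x = 0 -> adj y *m (H *m x) = 0) ->
  exists c, H = c%:M.
Proof.
move=> h; have ent (A : 'M[F]_n.+1) i j :
    adj (delta_mx i 0 : 'cV_n.+1) *m (A *m (delta_mx j 0 : 'cV_n.+1)) = (A i j)%:M.
  have -> : adj (delta_mx i 0 : 'cV_n.+1) = delta_mx 0 i.
    by apply/matrixP => a b; rewrite !mxE rmorph_nat andbC.
  rewrite -rowE -colE; apply/matrixP => a b.
  by rewrite !ord1 !mxE eqxx mulr1n.
have one i j := ent 1%:M i j; have {}one i j :
    adj (delta_mx i 0 : 'cV_n.+1) *m (delta_mx j 0 : 'cV_n.+1) = (i == j)%:R%:M.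
  by have := one i j; rewrite mul1mx mxE.
have s0 : (0 : F)%:M = 0 :> 'M_1 by apply/matrixP => a b; rewrite !mxE mul0rn.
have off i j : i != j -> H i j = 0.
  move=> ij; have := h (delta_mx j 0) (delta_mx i 0).
  rewrite one (negbTE ij) ent s0 => /(_ _ erefl) h'.
  have /h' /matrixP /(_ 0 0) : delta_mx j 0 != 0 :> 'cV[F]_n.+1.
    by apply/eqP => /colP /(_ j) /eqP; rewrite !mxE !eqxx oner_eq0.
  by rewrite !mxE eqxx mulr1n.
exists (H 0 0); apply/matrixP => i j; rewrite [RHS]mxE.
have [<-|ij] := eqVneq i j; last by rewrite off.
have [->|i0] := eqVneq i 0; first by rewrite mulr1n.
have x0 : delta_mx i 0 + delta_mx 0 0 != 0 :> 'cV[F]_n.+1.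
  by apply/eqP => /colP /(_ i) /eqP; rewrite !mxE !eqxx (negbTE i0) addr0 oner_eq0.
have := h _ (delta_mx i 0 - delta_mx 0 0) x0.
rewrite adjB !mulmxDr !mulmxBl !one !ent !eqxx (negbTE i0) [0 == i]eq_sym (negbTE i0).
rewrite !(off i 0) // (off 0 i) 1?eq_sym // s0 !subr0 !sub0r subrr => /(_ erefl).
by move=> /matrixP /(_ 0 0); rewrite !mxE !eqxx !mulr1n => /eqP; rewrite subr_eq0 => /eqP.
Qed.

Lemma mul_adj_diag n (A : 'M[F]_n) i : (A *m adj A) i i = emb (nsq (row i A)^T).
Proof.
rewrite mxE rmorph_sum; apply: eq_bigr => k _.
by rewrite !mxE ab2E.
Qed.

Lemma unitmx_row_neq0 n (A : 'M[F]_n) i : A \in unitmx -> (row i A)^T != 0.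
Proof.
move=> uA; apply/eqP => h; have : row i A *m invmx A = 0.
  by rewrite -[row i A]trmxK h trmx0 mul0mx.
rewrite -row_mul mulmxV // => /rowP /(_ i) /eqP.
by rewrite !mxE eqxx oner_eq0.
Qed.

Lemma mul_adj_scalar n (A : 'M[F]_n.+1) c : A \in unitmx -> A *m adj A = c%:M ->
  exists2 p, 0 < p & A *m adj A = (emb p)%:M.
Proof.
move=> uA h; exists (nsq (row 0 A)^T); first by rewrite nsq_gt0 unitmx_row_neq0.
rewrite -mul_adj_diag h; congr _%:M.
by rewrite mxE eqxx mulr1n.
Qed.

Lemma unitaryC n (U : 'M[F]_n) : unitary cj U -> U *m adj U = 1%:M.
Proof. exact: mulmx1C. Qed.

Lemma unitary_perm n (s : 'S_n) : unitary cj (perm_mx s : 'M[F]_n).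
Proof. by rewrite /unitary /Defs.adj tr_perm_mx map_perm_mx -perm_mxM (mulVg s) perm_mx1. Qed.

(* For H = Q Q^* every W H W^* is a multiple of H; taking W a sign change or a transposition makes H scalar. *)
Lemma unitary_conj_scalar n (P Q : 'M[F]_n.+3) : P \in unitmx -> Q \in unitmx ->
  (forall W, unitary cj W -> exists c, (P *m W *m Q) *m adj (P *m W *m Q) = c%:M) ->
  (exists2 p, 0 < p & P *m adj P = (emb p)%:M) /\
  (exists2 q, 0 < q & Q *m adj Q = (emb q)%:M).
Proof.
move=> uP uQ h; pose H := Q *m adj Q; pose D := invmx P *m invmx (adj P).
have uaP : adj P \in unitmx by rewrite /Defs.adj map_unitmx unitmx_tr.
have conj W : unitary cj W -> exists c, W *m H *m adj W = c *: D.
  move=> /h [c e]; exists c; rewrite !adjM in e.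
  have {}e : P *m (W *m H *m adj W) *m adj P = c%:M by rewrite -e /H !mulmxA.
  have -> : W *m H *m adj W = invmx P *m c%:M *m invmx (adj P).
    by rewrite -e !mulmxA mulVmx // mul1mx -!mulmxA mulmxV // mulmx1.
  by rewrite mul_mx_scalar -scalemxAl.
have un1 : unitary cj (1%:M : 'M[F]_n.+3) by rewrite /unitary adj1 mulmx1.
have [c1 e1] := conj _ un1; rewrite mul1mx adj1 mulmx1 in e1.
have H0 i : H i i != 0 by rewrite mul_adj_diag fmorph_eq0 nsq_eq0 unitmx_row_neq0.
have c10 : c1 != 0.
  by apply: contraNneq (H0 0) => c10; rewrite e1 c10 scale0r mxE.
(* W = 1 shows that H is a nonzero multiple of D, so H can replace D. *)
have {}conj W : unitary cj W -> exists c, W *m H *m adj W = c *: H.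
  move=> /conj [c ->]; exists (c / c1).
  by rewrite e1 scalerA divfK.
have off i j : i != j -> H i j = 0.
  (* d changes the sign of coordinate i: entry (j, j) gives c = 1, and entry (i, j) then gives H i j
     = - H i j. *)
  move=> ij; pose d := \row_k (if k == i then -1 else 1 : F).
  have cd k : cj (d 0 k) = d 0 k.
    by rewrite mxE; case: ifP; rewrite ?rmorphN rmorph1.
  have ad : adj (diag_mx d) = diag_mx d.
    apply/matrixP => a b; rewrite !mxE [b == a]eq_sym; case: (eqVneq a b) => [->|_].
      by rewrite !mulr1n; have := cd b; rewrite !mxE.
    by rewrite !mulr0n rmorph0.
  have [c hc] : exists c, diag_mx d *m H *m adj (diag_mx d) = c *: H.
    apply: conj; rewrite /unitary ad mul_diag_mx; apply/matrixP => a b.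
    rewrite !mxE; case: (eqVneq a b) => [->|_]; last by rewrite mulr0n mulr0.
    by rewrite !mulr1n; case: ifP; rewrite ?mulrNN mulr1.
  have ent a b : d 0 a * H a b * d 0 b = c * H a b.
    move/matrixP: hc => /(_ a b); rewrite ad mul_mx_diag mul_diag_mx.
    by rewrite !mxE.
  have c_1 : c = 1.
    have := ent j j; rewrite mxE eq_sym (negbTE ij) mul1r mulr1 => /esym/eqP.
    by rewrite -subr_eq0 -{2}[H j j]mul1r -mulrBl mulf_eq0 (negbTE (H0 j)) orbF subr_eq0 => /eqP.
  have := ent i j; rewrite !mxE eqxx eq_sym (negbTE ij) mulr1 mulN1r c_1 mul1r => /eqP.
  rewrite eq_sym -addr_eq0 -mulr2n -mulr_natl mulf_eq0 -(rmorph_nat emb) fmorph_eq0.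
  by rewrite pnatr_eq0 => /eqP.
have diagE i j : H i i = H j j.
  (* A third index is fixed by the transposition of i and j, and its diagonal entry gives c = 1. *)
  have [k /andP[ki kj]] : exists k, (k != i) && (k != j).
    apply/existsP; apply: contraT => /existsPn hk.
    have : #|pred2 i j| = #|'I_n.+3|.
      by apply: eq_card => k; rewrite !inE; have := hk k; rewrite negb_and !negbK.
    by rewrite card_ord card2; case: (i != j).
  have [c hc] := conj _ (unitary_perm (tperm i j)).
  have ent a : H (tperm i j a) (tperm i j a) = c * H a a.
    move/matrixP: hc => /(_ a a); rewrite [RHS]mxE => <-.
    rewrite /Defs.adj tr_perm_mx map_perm_mx -row_permE -col_permE.
    by rewrite !mxE.
  have c_1 : c = 1.
    have := ent k; rewrite tpermD 1?eq_sym // => /esym/eqP.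
    by rewrite -subr_eq0 -{2}[H k k]mul1r -mulrBl mulf_eq0 (negbTE (H0 k)) orbF subr_eq0 => /eqP.
  by have := ent j; rewrite tpermR c_1 mul1r.
have HE : Q *m adj Q = (H 0 0)%:M.
  apply/matrixP => i j; rewrite [RHS]mxE -/H.
  by have [<-|ij] := eqVneq i j; [rewrite mulr1n; apply: diagE | rewrite off].
have [q q0 hq] := mul_adj_scalar uQ HE.
split; last by exists q.
(* With W = 1 and Q Q^* = q, the scalar c equals q P P^*. *)
have [c hc] := h _ un1; apply: (@mul_adj_scalar _ _ (c / emb q) uP).
have eq0 : emb q != 0 by rewrite fmorph_eq0 gt_eqF.
apply: (scalerI eq0); rewrite scale_scalar_mx mulrC divfK // -hc mulmx1 adjM.
by rewrite -mulmxA (mulmxA Q) hq mul_scalar_mx scalemxAr.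
Qed.

Lemma normalize_unitary n (P : 'M[F]_n) p : 0 < p -> P *m adj P = (emb p)%:M ->
  exists2 U, unitary cj U & P = emb (Num.sqrt p) *: U.
Proof.
move=> p0 h; have s0 : emb (Num.sqrt p) != 0 by rewrite fmorph_eq0 gt_eqF // sqrtr_gt0.
exists ((emb (Num.sqrt p))^-1 *: P); last by rewrite scalerA mulfV // scale1r.
apply: mulmx1C; rewrite adjZ fmorphV cj_emb -scalemxAl -scalemxAr scalerA h.
rewrite scale_scalar_mx -invfM -rmorphM -expr2 sqr_sqrtr ?ltW // mulVf //.
by rewrite fmorph_eq0 gt_eqF.
Qed.

(** * Entrywise conjugation, unitary factors and top vectors *)

Lemma cmxK m n (A : 'M[F]_(m, n)) : cmx cj (cmx cj A) = A.
Proof. by apply/matrixP => i j; rewrite !mxE cjK. Qed.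

Lemma cmxM m n p (A : 'M[F]_(m, n)) (B : 'M_(n, p)) : cmx cj (A *m B) = cmx cj A *m cmx cj B.
Proof. exact: map_mxM. Qed.

Lemma adj_cmx m n (A : 'M[F]_(m, n)) : adj (cmx cj A) = cmx cj (adj A).
Proof. by apply/matrixP => i j; rewrite !mxE. Qed.

Lemma nsq_cmx n (x : 'cV[F]_n) : nsq (cmx cj x) = nsq x.
Proof. by apply: eq_bigr => i _; rewrite mxE ab2_cj. Qed.

Lemma unitary_cmx n (U : 'M[F]_n) : unitary cj U -> unitary cj (cmx cj U).
Proof. by rewrite /unitary adj_cmx -cmxM => ->; rewrite /cmx map_mx1. Qed.

Lemma nsq_unitary n (U : 'M[F]_n) x : unitary cj U -> nsq (U *m x) = nsq x.
Proof.
move=> h; apply: nsq_inj1.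
by rewrite adjM -mulmxA (mulmxA (adj U)) h mul1mx adj_mul_self.
Qed.

Lemma unitary_adj n (U : 'M[F]_n) : unitary cj U -> unitary cj (adj U).
Proof. by move=> h; rewrite /unitary adjK unitaryC. Qed.

Lemma top_unitary n (A U V : 'M[F]_n.+1) r u : 0 < r -> unitary cj U -> unitary cj V ->
  u != 0 -> top A u -> top (emb r *: (U *m A *m V)) (U *m u).
Proof.
move=> r0 hU hV u0 hu.
have Uu0 : U *m u != 0 by rewrite -nsq_eq0 nsq_unitary ?nsq_eq0.
apply: (proj2 (@top_intro _ _ _ (r * N A) _ Uu0 _ _)).
- by rewrite mulr_ge0 ?specnorm_ge0 ?ltW.
- move=> z; rewrite -scalemxAl nsqZ ab2_emb -!mulmxA nsq_unitary //.
  rewrite exprMn -(mulrA (r ^+ 2)) ler_pM2l ?exprn_gt0 //.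
  by rewrite -(nsq_unitary z hV); apply: specnorm_opbound.
- rewrite adjZ cj_emb !adjM -!scalemxAl -!scalemxAr scalerA -!mulmxA (mulmxA _ U) hU mul1mx.
  rewrite (mulmxA V) unitaryC // mul1mx hu -!scalemxAr scalerA -!rmorphM.
  by rewrite exprMn -!expr2.
Qed.

Lemma top_cmx n (A : 'M[F]_n.+1) u : u != 0 -> top A u -> top (cmx cj A) (cmx cj u).
Proof.
move=> u0 hu; have cu0 : cmx cj u != 0 by rewrite -nsq_eq0 nsq_cmx nsq_eq0.
apply: (proj2 (top_intro (specnorm_ge0 A) cu0 _ _)).
  by move=> z; rewrite -(nsq_cmx z) -{1}[z]cmxK -cmxM nsq_cmx; apply: specnorm_opbound.
by rewrite adj_cmx -!cmxM hu /cmx map_mxZ cj_emb.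
Qed.

(** * Between (i) and (iii) *)

Lemma cond_iii_i n (T : 'M[F]_n.+1 -> 'M[F]_n.+1) :
  cond_iii cj emb T -> cond_i cj ab2 T.
Proof.
case=> r [r0 [U [V [hU [hV hT]]]]] A B /norm_mult_top [u [u0 hA hB]].
apply/norm_mult_top.
have Un (x : 'cV[F]_n.+1) : x != 0 -> U *m x != 0.
  by move=> x0; rewrite -nsq_eq0 nsq_unitary ?nsq_eq0.
case: hT => hT; rewrite !hT.
  by exists (U *m u); split; [exact: Un | exact: top_unitary | exact: top_unitary].
have cu0 : cmx cj u != 0 by rewrite -nsq_eq0 nsq_cmx nsq_eq0.
exists (U *m cmx cj u); split; first exact: Un.
  by apply: top_unitary => //; apply: top_cmx.
by apply: top_unitary => //; apply: top_cmx.
Qed.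

Lemma cond_i_iii n (T : 'M[F]_n.+3 -> 'M[F]_n.+3) :
  bijective T -> real_linear emb T -> cond_i cj ab2 T -> cond_iii cj emb T.
Proof.
move=> [S TK SK] [TD TZ] hT.
have T_inj : injective T := can_inj TK.
have SD A B : S (A + B) = S A + S B by apply: T_inj; rewrite TD !SK.
have SZ r A : S (emb r *: A) = emb r *: S A by apply: T_inj; rewrite TZ !SK.
have sT B : exists A, T A = B by exists (S B).
have htop := cond_i_top sT hT.
have Sker (xi : 'rV[F]_n.+3) : xi != 0 ->
    exists2 eta : 'rV[F]_n.+3, eta != 0 & forall B, xi *m B = 0 -> eta *m S B = 0.
  move=> xi0; have x0 : adj xi != 0 by rewrite adj_eq0.
  have [u u0 hu] := htop _ x0; exists (adj u); first by rewrite adj_eq0.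
  by move=> B hB; apply: (kernel_transfer TD TZ SD SK u0 x0 hu); rewrite adjK.
(* As W W^* = 1, every u is an eigenvector, so y^* T(W) T(W)^* x = 0 for all orthogonal x and y. *)
have Tun W : unitary cj W -> exists c, T W *m adj (T W) = c%:M.
  move=> hW; apply: orth_scalar => x y x0 yx; have [u u0 hu] := htop _ x0.
  rewrite -mulmxA; apply: (eigen_gram TD TZ u0 hu yx (c := 1)).
  by rewrite mulmxA unitaryC // mul1mx scale1r.
have [M [Q SE]] := row_structure SD SZ (can_inj SK) (fun A => ex_intro _ (T A) (TK A)) Sker.
(* S(T(1)) = 1 writes 1 as a product with M as first and Q as last factor. *)
have [uM uQ] : M \in unitmx /\ Q \in unitmx.
  by case: SE => SE; have := TK 1%:M; rewrite SE => h;
    have [h1 h2] := mulmx1_unit h; split => //; move: h1; rewrite unitmx_mul => /andP[].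
suff [P [Q' [uP [uQ' TE]]]] : exists P Q' : 'M[F]_n.+3, P \in unitmx /\ Q' \in unitmx /\
    ((forall A, T A = P *m A *m Q') \/ (forall A, T A = P *m cmx cj A *m Q')).
  have hPQ W : unitary cj W -> exists c, (P *m W *m Q') *m adj (P *m W *m Q') = c%:M.
    move=> hW; case: TE => TE; first by rewrite -TE; apply: Tun.
    by rewrite -[W]cmxK -TE; apply: Tun; apply: unitary_cmx.
  have [[p p0 hp] [q q0 hq]] := unitary_conj_scalar uP uQ' hPQ.
  have [U hU PE] := normalize_unitary p0 hp.
  have [V hV QE] := normalize_unitary q0 hq.
  exists (Num.sqrt p * Num.sqrt q); split; first by rewrite mulr_gt0 ?sqrtr_gt0.
  exists U, V; split=> //; split=> //.
  have e A : P *m A *m Q' = emb (Num.sqrt p * Num.sqrt q) *: (U *m A *m V).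
    by rewrite PE QE -!scalemxAl -!scalemxAr scalerA -rmorphM.
  by case: TE => TE; [left|right] => A; rewrite TE e.
have inv X A : X = M *m A *m Q -> A = invmx M *m X *m invmx Q.
  by move=> ->; rewrite !mulmxA mulVmx // mul1mx -mulmxA mulmxV // mulmx1.
case: SE => SE.
  exists (invmx M), (invmx Q); rewrite !unitmx_inv; do 2!split => //; left => A.
  by apply: inv; rewrite -SE TK.
(* Solving for the conjugate of A and conjugating once more moves the conjugation onto the
   factors. *)
exists (cmx cj (invmx M)), (cmx cj (invmx Q)).
rewrite /cmx !map_unitmx !unitmx_inv; do 2!split => //; right => A.
rewrite -!cmxM -[LHS]cmxK; congr (cmx cj _).
by apply: inv; rewrite -SE TK.
Qed.

(** * Exchanging (i) and (ii) by the adjoint *)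

Definition adj_conj n (T : 'M[F]_n -> 'M[F]_n) A := adj (T (adj A)).

Lemma cond_i_adj_conj n (T : 'M[F]_n.+1 -> 'M[F]_n.+1) :
  cond_i cj ab2 (adj_conj T) <-> cond_ii cj ab2 T.
Proof.
split=> h A B; [have := h (adj A) (adj B) | have := h (adj A) (adj B)].
  by rewrite /adj_conj !adjK !specnorm_adj.
by rewrite /adj_conj !adjK !specnorm_adj.
Qed.

Lemma cond_iii_adj_conj n (T : 'M[F]_n -> 'M[F]_n) :
  cond_iii cj emb T -> cond_iii cj emb (adj_conj T).
Proof.
case=> r [r0 [U [V [hU [hV hT]]]]].
exists r; split=> //; exists (adj V), (adj U); do 2!(split; first exact: unitary_adj).
case: hT => hT; [left|right] => A; rewrite /adj_conj hT adjZ cj_emb !adjM mulmxA ?adjK //.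
by rewrite -adj_cmx adjK.
Qed.

Lemma real_linear_adj_conj n (T : 'M[F]_n -> 'M[F]_n) :
  real_linear emb T -> real_linear emb (adj_conj T).
Proof.
move=> [TD TZ]; split=> [A B|r A]; first by rewrite /adj_conj !adjD TD adjD.
by rewrite /adj_conj adjZ cj_emb TZ adjZ cj_emb.
Qed.

Lemma bijective_adj_conj n (T : 'M[F]_n -> 'M[F]_n) :
  bijective T -> bijective (adj_conj T).
Proof.
move=> [S TK SK]; exists (adj_conj S) => A; rewrite /adj_conj adjK.
  by rewrite TK adjK.
by rewrite SK adjK.
Qed.

Lemma norm_mult_preservers : Thm6 cj ab2 emb.
Proof.
move=> [|[|[|n]]] // T _ bT lT.
have iii_T : cond_iii cj emb (adj_conj T) -> cond_iii cj emb T.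
  move=> /cond_iii_adj_conj [r [r0 [U [V [hU [hV h]]]]]].
  exists r; split=> //; exists U, V; split=> //; split=> //.
  by case: h => h; [left|right] => A; rewrite -h /adj_conj !adjK.
(* (i) reaches (ii) through (iii), which passes to [adj_conj T] and gives (i) there. *)
split; first by move/(cond_i_iii bT lT)/cond_iii_adj_conj/cond_iii_i/cond_i_adj_conj.
split; last exact: cond_iii_i.
move/cond_i_adj_conj/(cond_i_iii (bijective_adj_conj bT) (real_linear_adj_conj lT)).
exact: iii_T.
Qed.

End SpectralNorm.

(** * The real and the complex field *)

Theorem mainTheorem6 (R : realType) : Thm6_real R /\ Thm6_complex R.
Proof.
split.
  apply: (@norm_mult_preservers R R idfun idfun (fun x => x ^+ 2)) => //=.
  - by move=> z; rewrite sqr_ge0.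
  - by move=> th _ _ h; left.
apply: (@norm_mult_preservers R R[i] (@conjc R) (@real_complex R)
  (fun z => complex.Re z ^+ 2 + complex.Im z ^+ 2)).
- exact: conjcK.
- exact: conjc_real.
- by case=> a b; apply/eqP; rewrite eq_complex /=; apply/andP; split; apply/eqP; ring.
- by move=> z; rewrite addr_ge0 ?sqr_ge0.
move=> th thD thM thr.
(* The image of i squares to -1, so it is i or -i, and it determines th. *)
have th_i : th 'i%C ^+ 2 = -1.
  by rewrite expr2 -thM -expr2 sqr_i -(rmorph1 (real_complex R)) -rmorphN thr.
have thE z : th z = (complex.Re z)%:C%C + (complex.Im z)%:C%C * th 'i%C.
  by rewrite {1}[z]complexE thD thr mulrC thM thr.
have : (th 'i%C - 'i%C) * (th 'i%C + 'i%C) = 0 by rewrite -subr_sqr th_i sqr_i subrr.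
move/eqP; rewrite mulf_eq0 subr_eq0 addr_eq0 => /orP[] /eqP hi; [left|right] => z.
  by rewrite thE hi {3}[z]complexE mulrC.
rewrite thE hi; case: z => a b; apply/eqP; rewrite eq_complex /=.
by apply/andP; split; apply/eqP; ring.
Qed.
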